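(* Let $A,B,C,\alpha_0,\beta_0,\gamma_0$ be real with $C>0$ and $\beta_0>C$, and put $\nu=(\beta_0-C)/C>0$. Let $W(t)=\sum_{n\ge 0}w_{n,0}\,t^n/n!$ be the exponential generating function of weighted returns of the affine Motzkin path model, and let $F_\nu,L_\nu$ be the functions defined in the context. Then $W$ is the unique function, analytic near the origin and satisfying $W(0)=1$, for which $$F_\nu(T)=\int_0^T L_\nu(v)\,W(T-v)\,dv$$ holds for all sufficiently small $T>0$.
   Context: Affine weighted Motzkin paths: a path starts at height $0$, never goes below height $0$, and uses steps $k\to k+1$ of weight $\alpha_k=Ak+\alpha_0$, $k\to k$ of weight $\gamma_k=Bk+\gamma_0$, and $k+1\to k$ of weight $\beta_k=Ck+\beta_0$ (down-steps are indexed by their arrival height), for $k\ge0$. The weight of a path is the product of its step weights (the empty path has weight $1$; weights may be negative, giving signed totals). $w_{n,k}$ is the total weight of all such paths of length $n$ ending at height $k$. Put $Q(x)=Ax^2+Bx+C$ and $\delta=\beta_0-C=\nu C$. Let $X$ be the solution near $0$ of $X'(\tau)=Q(X(\tau))$, $X(0)=0$; since $X'(0)=C>0$, $X(\tau)>0$ for small $\tau>0$. For small $\tau>0$ define $$F_\nu(\tau)=X(\tau)^\nu\exp\Big(\int_0^\tau\big[(\alpha_0-\nu A)X(r)+\gamma_0-\nu B\big]\,dr\Big),\qquad L_\nu(\tau)=\frac{\delta F_\nu(\tau)}{X(\tau)},$$ where $X(\tau)^\nu$ is the positive real power. *)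

(* Defs.v *)
From Stdlib Require Import Reals List Arith.
From Coquelicot Require Import Coquelicot.
Open Scope R_scope.

Inductive step : Set := Up | Level | Down.

(* Height reached from height h; None if the path goes below height 0. *)
Fixpoint end_height (h : nat) (p : list step) : option nat :=
  match p with
  | nil => Some h
  | Up :: q => end_height (S h) q
  | Level :: q => end_height h q
  | Down :: q => match h with O => None | S k => end_height k q end
  end.

Definition ends_at (k : nat) (p : list step) : bool :=
  match end_height 0 p with Some h => Nat.eqb h k | None => false end.

Fixpoint words (n : nat) : list (list step) :=
  match n with
  | O => nil :: nil
  | S m => flat_map (fun p => (Up :: p) :: (Level :: p) :: (Down :: p) :: nil)
                    (words m)
  end.

Definition motzkin_paths (n k : nat) : list (list step) :=
  filter (ends_at k) (words n).

(* Down-steps are indexed by their arrival height. The value on paths going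
   below height 0 is irrelevant: they are not in motzkin_paths. *)
Fixpoint path_weight (alpha beta gamma : nat -> R) (h : nat) (p : list step)
  : R :=
  match p with
  | nil => 1
  | Up :: q => alpha h * path_weight alpha beta gamma (S h) q
  | Level :: q => gamma h * path_weight alpha beta gamma h q
  | Down :: q => beta (pred h) * path_weight alpha beta gamma (pred h) q
  end.

Definition affine (a b : R) (k : nat) : R := a * INR k + b.

Definition total_weight (A B C alpha0 beta0 gamma0 : R) (n k : nat) : R :=
  fold_right Rplus 0
    (map (path_weight (affine A alpha0) (affine C beta0) (affine B gamma0) 0)
         (motzkin_paths n k)).

Definition return_coeff (A B C alpha0 beta0 gamma0 : R) (n : nat) : R :=
  total_weight A B C alpha0 beta0 gamma0 n 0 / INR (fact n).

Definition W (A B C alpha0 beta0 gamma0 : R) : R -> R :=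
  PSeries (return_coeff A B C alpha0 beta0 gamma0).

Definition Q (A B C x : R) : R := A * x ^ 2 + B * x + C.

Definition riccati_solution (A B C : R) (X : R -> R) : Prop :=
  X 0 = 0 /\ locally 0 (fun t => is_derive X t (Q A B C (X t))).

(* Meaningful only for small tau > 0, where X tau > 0. *)
Definition F (A B alpha0 gamma0 nu : R) (X : R -> R) (tau : R) : R :=
  Rpower (X tau) nu *
  exp (RInt (fun r => (alpha0 - nu * A) * X r + gamma0 - nu * B) 0 tau).

Definition L (A B alpha0 gamma0 nu delta : R) (X : R -> R) (tau : R) : R :=
  delta * F A B alpha0 gamma0 nu X tau / X tau.

(* The integral is improper at 0, where l may be unbounded. *)
Definition convolution_equation (f l w : R -> R) : Prop :=
  at_right 0 (fun T =>
    is_RInt_gen (fun v => l v * w (T - v)) (at_right 0) (at_point T) (f T)).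

(* Convergence on a neighbourhood forces a positive radius of convergence. *)
Definition has_expansion_at_0 (f : R -> R) (a : nat -> R) : Prop :=
  locally 0 (fun x => is_pseries a x (f x)).

Definition analytic_at_0 (f : R -> R) : Prop :=
  exists a : nat -> R, has_expansion_at_0 f a.

(* Main.v *)
Require Import Defs.
From Stdlib Require Import Reals List Arith Lra Lia.
From Coquelicot Require Import Coquelicot.
Open Scope R_scope.

(** Let [P t x] be the generating function of all weighted paths, exponential in
    the length (variable [t]) and ordinary in the final height (variable [x]).
    Removing the last step of a path ([path_total_last_step]) and using that the
    weights are affine in the height gives the first-order equation
    [dP/dt = Q x * dP/dx + (alpha0 x + gamma0 + delta / x) * P - delta / x * W t]
    with [P 0 x = 1] and [W t = P t 0]; the singular terms come from the
    excess [delta = beta0 - C] of the down-step weights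
    ([height_poly_last_step]).

    The solution [X] of the Riccati equation parametrises the characteristics,
    and [F] is the integrating factor for the zeroth-order terms
    ([is_derive_F]). Therefore
    [d/dv (F v * P (T - v) (X v)) = L v * W (T - v)]. Integrating from 0 to [T]
    gives the convolution equation: at [v = T] the bracket is [F T], and at
    [v = 0] it vanishes since [nu > 0] ([F_lim_0]).

    Convergence of the double series [P] and termwise differentiation are
    avoided by working with the polynomials obtained by keeping paths of length
    at most [N]. For these the identity holds up to one explicit error term, because
    the sum over the lengths telescopes ([is_derive_characteristic_sum]). The
    coefficients are at most [rho ^ n] ([path_coeff_bound]), so for [T] small
    the error decays geometrically in [N]; this yields the equation on
    [[eps, T]] up to [4 * F eps] ([truncated_convolution]), and then [eps]
    tends to 0.

    Uniqueness rests on positivity. The kernel [L] is positive to the right of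
    0, and the difference of two analytic solutions, if not zero near 0, has a
    constant sign just to the right of 0. Then its convolution with [L] cannot
    vanish ([convolution_equation_unique]). *)

(** * Last-step decomposition and growth of the path weights *)

(** Starting from an arbitrary height [h], rather than from 0, is what makes
    induction on the length possible: removing the first letter of a word
    changes the starting height. *)
Definition path_total (alpha beta gamma : nat -> R) (n h k : nat) : R :=
  fold_right Rplus 0
    (map (path_weight alpha beta gamma h)
       (filter (fun p => match end_height h p with
                         | Some j => Nat.eqb j k | None => false end)
          (words n))).

Lemma path_total_0 alpha beta gamma h k :
  path_total alpha beta gamma 0 h k = if Nat.eqb h k then 1 else 0.
Proof.
unfold path_total; simpl.
destruct (Nat.eqb h k); simpl; ring.
Qed.

Lemma path_total_first_step alpha beta gamma n h k :
  path_total alpha beta gamma (S n) h k =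
  alpha h * path_total alpha beta gamma n (S h) k
  + gamma h * path_total alpha beta gamma n h k
  + match h with
    | O => 0
    | S j => beta j * path_total alpha beta gamma n j k
    end.
Proof.
unfold path_total; simpl words.
induction (words n) as [|p ps IH].
- destruct h; simpl; ring.
- destruct h as [|h]; simpl in IH |- *.
  + destruct (end_height 1 p) as [i|]; [destruct (Nat.eqb i k)|];
    (destruct (end_height 0 p) as [j|]; [destruct (Nat.eqb j k)|]);
    simpl; rewrite IH; ring.
  + destruct (end_height (S (S h)) p) as [i|]; [destruct (Nat.eqb i k)|];
    (destruct (end_height (S h) p) as [j|]; [destruct (Nat.eqb j k)|]);
    (destruct (end_height h p) as [l|]; [destruct (Nat.eqb l k)|]);
    simpl; rewrite IH; ring.
Qed.

(** One step of the transfer operator of the walk: if [w k] is the weight of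
    the paths ending at height [k], this is the weight after one more step. *)
Definition last_step (alpha beta gamma w : nat -> R) (k : nat) : R :=
  match k with O => 0 | S j => alpha j * w j end
  + gamma k * w k + beta k * w (S k).

(** Words grow at their front, whereas the differential equation below needs
    the last step. The two decompositions agree because both compute the powers
    of the same tridiagonal matrix, and a matrix commutes with its powers. *)
Lemma path_total_last_step alpha beta gamma n h k :
  path_total alpha beta gamma (S n) h k =
  last_step alpha beta gamma (path_total alpha beta gamma n h) k.
Proof.
revert h k; induction n as [|n IH]; intros h k.
- rewrite path_total_first_step; unfold last_step.
  destruct h as [|h], k as [|k]; rewrite !path_total_0;
  repeat match goal with |- context [Nat.eqb ?a ?b] =>
    destruct (Nat.eqb_spec a b) end; try lia;
  repeat match goal with H : S _ = S _ |- _ => injection H as H end;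
  subst; ring.
- rewrite path_total_first_step.
  destruct h as [|h], k as [|k]; rewrite !IH; unfold last_step;
  rewrite !(path_total_first_step _ _ _ n); ring.
Qed.

Lemma path_total_above alpha beta gamma n h k :
  (h + n < k)%nat -> path_total alpha beta gamma n h k = 0.
Proof.
revert k; induction n as [|n IH]; intros k Hk.
- rewrite path_total_0; destruct (Nat.eqb_spec h k); [lia|reflexivity].
- rewrite path_total_last_step; unfold last_step.
  destruct k as [|k]; [lia|].
  rewrite !IH by lia; ring.
Qed.

(** After [n] steps a path is at height at most [n], so each of the three last
    steps multiplies a weight by at most [K * (n + 1)]. The factorial is exactly
    what the exponential generating function divides out. *)
Lemma path_total_bound alpha beta gamma K :
  0 <= K ->
  (forall k, Rabs (alpha k) <= K * (INR k + 1)) ->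
  (forall k, Rabs (beta k) <= K * (INR k + 1)) ->
  (forall k, Rabs (gamma k) <= K * (INR k + 1)) ->
  forall n k,
  Rabs (path_total alpha beta gamma n 0 k) <= (3 * K) ^ n * INR (fact n).
Proof.
intros HK Ha Hb Hc n; induction n as [|n IH]; intros k.
- rewrite path_total_0; destruct (Nat.eqb 0 k); simpl;
  [rewrite Rabs_R1|rewrite Rabs_R0]; lra.
- assert (Hpos : 0 <= (3 * K) ^ n * INR (fact n)).
  { apply Rmult_le_pos; [apply pow_le; lra|apply pos_INR]. }
  (* Every step that contributes has both ends at height at most n + 1. *)
  assert (Hterm : forall x i j, Rabs x <= K * (INR i + 1) -> (i <= j)%nat ->
     Rabs (x * path_total alpha beta gamma n 0 j)
     <= K * INR (S n) * ((3 * K) ^ n * INR (fact n))).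
  { intros x i j Hx Hij.
    destruct (Nat.le_gt_cases j n) as [Hj|Hj].
    - rewrite Rabs_mult.
      apply Rmult_le_compat; try apply Rabs_pos; [|apply IH].
      apply Rle_trans with (1 := Hx).
      rewrite S_INR.
      apply Rmult_le_compat_l; [exact HK|].
      apply Rplus_le_compat_r, le_INR; lia.
    - rewrite path_total_above by lia.
      rewrite Rmult_0_r, Rabs_R0.
      apply Rmult_le_pos; [|exact Hpos].
      apply Rmult_le_pos; [exact HK|apply pos_INR]. }
  rewrite path_total_last_step; unfold last_step.
  replace ((3 * K) ^ S n * INR (fact (S n)))
    with (3 * (K * INR (S n) * ((3 * K) ^ n * INR (fact n))))
    by (rewrite fact_simpl, mult_INR; simpl pow; ring).
  assert (H2 := Hterm _ k k (Hc k) (le_n k)).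
  assert (H3 := Hterm _ k (S k) (Hb k) (le_S _ _ (le_n k))).
  assert (H1 : Rabs (match k with O => 0 | S j =>
      alpha j * path_total alpha beta gamma n 0 j end)
      <= K * INR (S n) * ((3 * K) ^ n * INR (fact n))).
  { destruct k as [|k].
    - rewrite Rabs_R0.
      apply Rmult_le_pos; [|exact Hpos].
      apply Rmult_le_pos; [exact HK|apply pos_INR].
    - exact (Hterm _ k k (Ha k) (le_n k)). }
  eapply Rle_trans; [apply Rabs_triang|].
  assert (H12 := Rabs_triang (match k with O => 0 | S j =>
      alpha j * path_total alpha beta gamma n 0 j end)
      (gamma k * path_total alpha beta gamma n 0 k)).
  lra.
Qed.

Lemma total_weight_path_total A B C alpha0 beta0 gamma0 n k :
  total_weight A B C alpha0 beta0 gamma0 n k =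
  path_total (affine A alpha0) (affine C beta0) (affine B gamma0) n 0 k.
Proof. reflexivity. Qed.

(** The Taylor coefficient of order [n] of the exponential generating function
    of paths ending at height [k]; for [k = 0] it is [return_coeff]. *)
Definition path_coeff (A B C alpha0 beta0 gamma0 : R) (n k : nat) : R :=
  total_weight A B C alpha0 beta0 gamma0 n k / INR (fact n).

Lemma path_coeff_0 A B C alpha0 beta0 gamma0 k :
  path_coeff A B C alpha0 beta0 gamma0 0 k = if Nat.eqb 0 k then 1 else 0.
Proof.
unfold path_coeff; rewrite total_weight_path_total, path_total_0; simpl; field.
Qed.

Lemma path_coeff_above A B C alpha0 beta0 gamma0 n k :
  (n < k)%nat -> path_coeff A B C alpha0 beta0 gamma0 n k = 0.
Proof.
intros Hk; unfold path_coeff; rewrite total_weight_path_total.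
rewrite path_total_above by lia; unfold Rdiv; ring.
Qed.

Lemma path_coeff_last_step A B C alpha0 beta0 gamma0 n k :
  INR (S n) * path_coeff A B C alpha0 beta0 gamma0 (S n) k =
  last_step (affine A alpha0) (affine C beta0) (affine B gamma0)
    (path_coeff A B C alpha0 beta0 gamma0 n) k.
Proof.
unfold path_coeff.
rewrite (total_weight_path_total _ _ _ _ _ _ (S n)), path_total_last_step,
  fact_simpl, mult_INR.
assert (Hf := INR_fact_neq_0 n).
assert (Hn : INR (S n) <> 0) by (apply not_0_INR; lia).
unfold last_step, total_weight, motzkin_paths, path_total, ends_at.
destruct k; field; auto.
Qed.

Lemma affine_bound K a b k :
  Rabs a + Rabs b <= K -> Rabs (affine a b k) <= K * (INR k + 1).
Proof.
intros H; unfold affine.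
assert (Hk := pos_INR k).
assert (Ha := Rabs_pos a); assert (Hb := Rabs_pos b).
eapply Rle_trans; [apply Rabs_triang|].
rewrite Rabs_mult, (Rabs_pos_eq (INR k)) by exact Hk.
nra.
Qed.

Lemma path_coeff_bound A B C alpha0 beta0 gamma0 :
  exists rho, 0 < rho /\
  forall n k, Rabs (path_coeff A B C alpha0 beta0 gamma0 n k) <= rho ^ n.
Proof.
set (K := Rabs A + Rabs B + Rabs C + Rabs alpha0 + Rabs beta0 + Rabs gamma0 + 1).
assert (HA := Rabs_pos A); assert (HB := Rabs_pos B).
assert (HC := Rabs_pos C); assert (Ha := Rabs_pos alpha0).
assert (Hb := Rabs_pos beta0); assert (Hc := Rabs_pos gamma0).
exists (3 * K); split; [unfold K; lra|].
intros n k; unfold path_coeff; rewrite total_weight_path_total.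
assert (Hf := INR_fact_lt_0 n).
unfold Rdiv; rewrite Rabs_mult, (Rabs_pos_eq (/ _))
  by (apply Rlt_le, Rinv_0_lt_compat, Hf).
apply (Rmult_le_reg_r (INR (fact n))); [exact Hf|].
rewrite Rmult_assoc, Rinv_l, Rmult_1_r by lra.
apply path_total_bound; try (intros; apply affine_bound); unfold K; lra.
Qed.

(** * Generating polynomials in the height *)

Lemma sum_n_succ (u : nat -> R) n : sum_n u (S n) = sum_n u n + u (S n).
Proof. exact (sum_Sn u n). Qed.

Definition height_poly (u : nat -> R) (M : nat) (x : R) : R :=
  sum_n (fun k => u k * x ^ k) M.

Definition height_poly_derive (u : nat -> R) (M : nat) (x : R) : R :=
  sum_n (fun k => INR k * u k * x ^ pred k) M.

Lemma height_poly_0 u x : height_poly u 0 x = u O.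
Proof. unfold height_poly; rewrite sum_O; simpl; ring. Qed.

Lemma height_poly_succ u M x :
  height_poly u (S M) x = height_poly u M x + u (S M) * x ^ S M.
Proof. exact (sum_n_succ _ _). Qed.

Lemma is_derive_height_poly u M x :
  is_derive (height_poly u M) x (height_poly_derive u M x).
Proof.
unfold height_poly, height_poly_derive; induction M as [|M IH].
- apply is_derive_ext with (fun _ => u O).
  + intros t; rewrite sum_O; simpl; ring.
  + rewrite sum_O; simpl INR; rewrite !Rmult_0_l.
    exact (is_derive_const _ _).
- apply is_derive_ext with
    (fun t => plus (sum_n (fun k => u k * t ^ k) M) (u (S M) * t ^ S M)).
  + intros t; rewrite sum_Sn; reflexivity.
  + rewrite sum_Sn.
    apply (@is_derive_plus R_AbsRing R_NormedModule); [exact IH|].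
    auto_derive; [exact I|].
    change (match M with O => 1 | S _ => INR M + 1 end) with (INR (S M)).
    simpl pred; ring.
Qed.

(** Multiplying the [k]-th entry by [x ^ k] turns the transfer operator into a
    first-order differential operator: [A k + alpha0], [B k + gamma0] give
    [A x^2 d/dx + alpha0 x] and [B x d/dx + gamma0], while
    [C k + beta0 = C (k + 1) + (beta0 - C)] gives [C d/dx] together with the
    singular term [(beta0 - C) (p(x) - p(0)) / x]. The identity is multiplied
    by [x] to avoid the division. The two vanishing conditions ensure that the
    cut-off [M] loses nothing. *)
Lemma height_poly_last_step A B C alpha0 beta0 gamma0 u M x :
  u M = 0 -> u (S M) = 0 ->
  x * height_poly (last_step (affine A alpha0) (affine C beta0) (affine B gamma0) u) M x
  = x * Q A B C x * height_poly_derive u M x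
    + (alpha0 * x ^ 2 + gamma0 * x + (beta0 - C)) * height_poly u M x
    - (beta0 - C) * u O.
Proof.
intros HM HSM.
(* Without the vanishing conditions there are two boundary terms, which make
   the identity provable by induction on the cut-off. *)
assert (Hbound : x * height_poly (last_step (affine A alpha0) (affine C beta0)
                            (affine B gamma0) u) M x
  = x * Q A B C x * height_poly_derive u M x
    + (alpha0 * x ^ 2 + gamma0 * x + (beta0 - C)) * height_poly u M x
    - (beta0 - C) * u O
    - affine A alpha0 M * u M * x ^ S (S M)
    + affine C beta0 M * u (S M) * x ^ S M).
{ clear HM HSM; unfold height_poly, height_poly_derive; induction M as [|M IH].
  - rewrite !sum_O; unfold last_step, affine; simpl; ring.
  - rewrite !sum_n_succ, Rmult_plus_distr_l, IH.
    unfold last_step, affine, Q; rewrite !S_INR; simpl pred; simpl pow; ring. }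
rewrite Hbound, HM, HSM; ring.
Qed.

(** * Power series near the origin *)

Lemma locally_0_Rabs (P : R -> Prop) :
  locally 0 P <-> exists r, 0 < r /\ forall x, Rabs x < r -> P x.
Proof.
split.
- intros [e He]; exists e; split; [apply cond_pos|].
  intros x Hx; apply He; change (Rabs (x - 0) < e).
  rewrite Rminus_0_r; exact Hx.
- intros [r [Hr H]]; exists (mkposreal r Hr).
  intros x Hx; change (Rabs (x - 0) < r) in Hx.
  rewrite Rminus_0_r in Hx; exact (H x Hx).
Qed.

Lemma locally_Rabs_lt (P : R -> Prop) (r x : R) :
  (forall y, Rabs y < r -> P y) -> Rabs x < r -> locally x P.
Proof.
intros HP Hx.
assert (Hp : 0 < r - Rabs x) by lra.
exists (mkposreal _ Hp); intros y Hy; apply HP.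
change (Rabs (y - x) < r - Rabs x) in Hy.
assert (Ht := Rabs_triang (y - x) x).
rewrite Rplus_comm, Rplus_minus in Ht; lra.
Qed.

Lemma geom_tail (u : nat -> R) (l : R) (N : nat) :
  is_series u l -> (forall n, Rabs (u n) <= (1 / 2) ^ n) ->
  Rabs (l - sum_n u N) <= (1 / 2) ^ N.
Proof.
intros Hl Hu.
assert (Hpart : forall m,
  Rabs (sum_n u (m + N) - sum_n u N) <= (1 / 2) ^ N * (1 - (1 / 2) ^ m)).
{ intros m; induction m as [|m IH].
  - rewrite Rminus_diag, Rabs_R0; simpl; lra.
  - rewrite Nat.add_succ_l, sum_n_succ.
    replace (sum_n u (m + N) + u (S (m + N)) - sum_n u N)
      with (sum_n u (m + N) - sum_n u N + u (S (m + N))) by ring.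
    eapply Rle_trans; [apply Rabs_triang|].
    specialize (Hu (S (m + N))).
    replace ((1 / 2) ^ S (m + N)) with ((1 / 2) ^ N * (1 / 2) ^ m * (1 / 2)) in Hu
      by (simpl pow; rewrite pow_add; ring).
    simpl pow; lra. }
assert (Hlim : is_lim_seq (fun m => Rabs (sum_n u (m + N) - sum_n u N))
                 (Rabs (l - sum_n u N))).
{ apply (is_lim_seq_abs _ (Finite (l - sum_n u N))).
  apply is_lim_seq_minus'; [|apply is_lim_seq_const].
  apply -> (is_lim_seq_incr_n (sum_n u) N). exact Hl. }
apply (is_lim_seq_le _ (fun _ => (1 / 2) ^ N) _ (Finite ((1 / 2) ^ N)))
  with (2 := Hlim) (3 := is_lim_seq_const _).
intros m; eapply Rle_trans; [apply Hpart|].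
assert (H1 : 0 <= (1 / 2) ^ N) by (apply pow_le; lra).
assert (H2 : 0 <= (1 / 2) ^ m) by (apply pow_le; lra).
nra.
Qed.

(** Convergence at one positive point bounds the radius of convergence from
    below, hence the choice of half the given neighbourhood. *)
Lemma expansion_radius (f : R -> R) (a : nat -> R) :
  has_expansion_at_0 f a ->
  exists r, 0 < r /\ forall x, Rabs x < r ->
    is_pseries a x (f x) /\ Rbar_lt (Rabs x) (CV_radius a).
Proof.
intros Hf.
destruct (proj1 (locally_0_Rabs _) Hf) as [e [Hpos Hball]].
exists (e / 2); split; [lra|].
intros x Hx; split; [apply Hball; lra|].
assert (Habs : Rabs (e / 2) = e / 2) by (apply Rabs_pos_eq; lra).
assert (Hle : Rbar_le (Rabs (e / 2)) (CV_radius a)).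
{ apply Rbar_not_lt_le; intros Hlt.
  apply (CV_disk_outside _ _ Hlt).
  apply ex_series_lim_0.
  apply ex_pseries_R.
  exists (f (e / 2)); apply Hball; lra. }
apply Rbar_lt_le_trans with (2 := Hle).
simpl; lra.
Qed.

Lemma expansion_continuous (f : R -> R) (a : nat -> R) :
  has_expansion_at_0 f a ->
  exists r, 0 < r /\ forall x, Rabs x < r -> continuous f x.
Proof.
intros Hf; destruct (expansion_radius _ _ Hf) as [r [Hr H]].
exists r; split; [exact Hr|].
intros x Hx.
apply continuous_ext_loc with (PSeries a).
- apply (locally_Rabs_lt _ r); [|exact Hx].
  intros y Hy; apply is_pseries_unique, H, Hy.
- apply continuity_pt_filterlim, PSeries_continuity, H, Hx.
Qed.

(** To the right of 0 the lowest non-zero term decides the sign: factor out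
    [t ^ m] and use continuity of the remaining series at 0. *)
Lemma expansion_pos (f : R -> R) (a : nat -> R) (m : nat) :
  has_expansion_at_0 f a -> (forall k, (k < m)%nat -> a k = 0) -> 0 < a m ->
  exists r, 0 < r /\ forall t, 0 < t < r -> 0 < f t.
Proof.
intros Hf Hzero Hm.
assert (Hg : has_expansion_at_0 (PSeries (PS_decr_n a m)) (PS_decr_n a m)).
{ unfold has_expansion_at_0 in *.
  revert Hf; apply filter_imp; intros x Hx.
  apply PSeries_correct, ex_pseries_decr_n; [|exists (f x); exact Hx].
  destruct (Req_dec x 0) as [Hx0|Hx0]; [left; exact Hx0|right].
  exists (/ x); exact (Rinv_l x Hx0). }
destruct (expansion_radius _ _ Hf) as [r1 [Hr1 H1]].
destruct (expansion_continuous _ _ Hg) as [r2 [Hr2 H2]].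
assert (Hc : locally 0 (fun x => 0 < PSeries (PS_decr_n a m) x)).
{ apply (H2 0); [rewrite Rabs_R0; exact Hr2|].
  apply (open_gt 0).
  rewrite PSeries_0; unfold PS_decr_n; rewrite Nat.add_0_r; exact Hm. }
destruct (proj1 (locally_0_Rabs _) Hc) as [e [He0 He]].
exists (Rmin r1 e); split; [apply Rmin_pos; assumption|].
intros t [Ht0 Ht].
assert (Hmin1 := Rmin_l r1 e); assert (Hmin2 := Rmin_r r1 e).
rewrite <- (is_pseries_unique a t (f t)).
- rewrite (PSeries_decr_n_aux a m t Hzero).
  apply Rmult_lt_0_compat; [apply pow_lt, Ht0|].
  apply He; rewrite Rabs_pos_eq; lra.
- apply H1; rewrite Rabs_pos_eq; lra.
Qed.

(** * The Riccati solution and the integrating factor *)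

(** Since [X' 0 = C], the ratio [X t / t] lies between [C / 2] and [3 C / 2]
    for small [t]; the upper bound gives [X t <= 1 / 2] when
    [t <= 1 / (3 C)]. The value [1 / 2] makes geometric series in [X t]
    sum to at most 2. *)
Lemma riccati_near_0 A B C (X : R -> R) :
  0 < C -> riccati_solution A B C X ->
  exists r, 0 < r /\
    (forall t, Rabs t < r -> is_derive X t (Q A B C (X t))) /\
    (forall t, 0 < t < r -> 0 < X t <= 1 / 2).
Proof.
intros HC [H0 Hloc].
destruct (proj1 (locally_0_Rabs _) Hloc) as [r [Hr HX]].
assert (HX0 : is_derive X 0 C).
{ replace C with (Q A B C (X 0)) by (rewrite H0; unfold Q; ring).
  apply HX; rewrite Rabs_R0; exact Hr. }
apply is_derive_Reals in HX0.
destruct (HX0 (C / 2)) as [d Hd]; [lra|].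
assert (Hinv : 0 < / (3 * C)) by (apply Rinv_0_lt_compat; lra).
assert (Hdp := cond_pos d).
exists (Rmin r (Rmin d (/ (3 * C)))).
assert (H1 := Rmin_l r (Rmin d (/ (3 * C)))).
assert (H2 := Rmin_r r (Rmin d (/ (3 * C)))).
assert (H3 := Rmin_l d (/ (3 * C))).
assert (H4 := Rmin_r d (/ (3 * C))).
split; [repeat apply Rmin_pos; lra|].
split; [intros t Ht; apply HX; lra|].
intros t [Ht0 Ht].
assert (Hq := Hd t ltac:(lra) ltac:(rewrite Rabs_pos_eq; lra)).
rewrite Rplus_0_l, H0, Rminus_0_r in Hq.
apply Rabs_def2 in Hq.
assert (Hx : X t = X t / t * t) by (field; lra).
assert (Hu : t * (3 * C) <= 1).
{ apply Rle_trans with (/ (3 * C) * (3 * C)); [|rewrite Rinv_l; lra].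
  apply Rmult_le_compat_r; lra. }
rewrite Hx; split; nra.
Qed.

Lemma is_derive_RInt_from_0 (g : R -> R) r :
  (forall s, Rabs s < r -> continuous g s) ->
  forall t, Rabs t < r -> is_derive (RInt g 0) t (g t).
Proof.
intros Hg t Ht.
apply is_derive_RInt with 0; [|apply Hg, Ht].
apply (locally_Rabs_lt _ r); [|exact Ht].
intros s Hs; apply (RInt_correct (V := R_CompleteNormedModule)).
apply (ex_RInt_continuous (V := R_CompleteNormedModule)).
intros z Hz; apply Hg.
revert Hz Hs; unfold Rmin, Rmax, Rabs; destruct (Rle_dec 0 s);
destruct (Rcase_abs s), (Rcase_abs z); lra.
Qed.

(** The [nu]-dependent parts of the exponent are chosen to cancel those of
    [nu * X' / X = nu * (A * X + B + C / X)], which leaves only the singular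
    term [nu * C / X]. Thus [F] is an integrating factor for the zeroth-order
    part of the operator in [height_poly_last_step]. *)
Lemma is_derive_F A B C alpha0 gamma0 nu (X : R -> R) r :
  (forall t, Rabs t < r -> is_derive X t (Q A B C (X t))) ->
  (forall t, 0 < t < r -> 0 < X t) ->
  forall t, 0 < t < r ->
  is_derive (F A B alpha0 gamma0 nu X) t
    (F A B alpha0 gamma0 nu X t * (alpha0 * X t + gamma0 + nu * C / X t)).
Proof.
intros HX Hpos t Ht.
set (g := fun s : R => (alpha0 - nu * A) * X s + gamma0 - nu * B).
assert (Hg : forall s, Rabs s < r -> continuous g s).
{ intros s Hs; apply (ex_derive_continuous (K := R_AbsRing) (V := R_NormedModule)).
  unfold g; auto_derive.
  exists (Q A B C (X s)); apply HX, Hs. }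
assert (Hint : is_derive (RInt g 0) t (g t)).
{ apply is_derive_RInt_from_0 with (1 := Hg).
  rewrite Rabs_pos_eq; lra. }
assert (HXt : is_derive X t (Q A B C (X t))) by (apply HX; rewrite Rabs_pos_eq; lra).
assert (Hp := Hpos t Ht).
apply is_derive_ext with (fun s => exp (nu * ln (X s)) * exp (RInt g 0 s)).
{ intros s; reflexivity. }
change (F A B alpha0 gamma0 nu X t) with (exp (nu * ln (X t)) * exp (RInt g 0 t)).
revert Hint; generalize (RInt g 0); intros h Hint.
auto_derive.
{ repeat split; [eexists; exact HXt|exact Hp|eexists; exact Hint]. }
change (Derive (fun x => X x) t) with (Derive X t).
change (Derive (fun x => h x) t) with (Derive h t).
rewrite (is_derive_unique X t _ HXt), (is_derive_unique h t _ Hint).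
unfold g, Q; field; lra.
Qed.

Lemma F_pos A B alpha0 gamma0 nu X t : 0 < F A B alpha0 gamma0 nu X t.
Proof. unfold F, Rpower; apply Rmult_lt_0_compat; apply exp_pos. Qed.

(** Since [0 < nu], the power [X ^ nu] tends to 0, and the exponential factor
    stays bounded. *)
Lemma F_lim_0 A B C alpha0 gamma0 nu (X : R -> R) r :
  0 < nu -> 0 < r -> X 0 = 0 ->
  (forall t, Rabs t < r -> is_derive X t (Q A B C (X t))) ->
  (forall t, 0 < t < r -> 0 < X t) ->
  filterlim (F A B alpha0 gamma0 nu X) (at_right 0) (locally 0).
Proof.
intros Hnu Hr HX0 HX Hpos.
set (g := fun s : R => (alpha0 - nu * A) * X s + gamma0 - nu * B).
assert (Hg : forall s, Rabs s < r -> continuous g s).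
{ intros s Hs; apply (ex_derive_continuous (K := R_AbsRing) (V := R_NormedModule)).
  unfold g; auto_derive.
  exists (Q A B C (X s)); apply HX, Hs. }
assert (H0 : Rabs 0 < r) by (rewrite Rabs_R0; exact Hr).
assert (Hint : continuous (RInt g 0) 0).
{ apply (ex_derive_continuous (K := R_AbsRing) (V := R_NormedModule)); exists (g 0).
  exact (is_derive_RInt_from_0 _ _ Hg 0 H0). }
assert (Hexp : filterlim (fun t => exp (RInt g 0 t)) (at_right 0)
                 (locally (exp (RInt g 0 0)))).
{ apply (filterlim_filter_le_1 (F := locally 0) (G := at_right 0));
  [apply filter_le_within; apply locally_filter|].
  apply (continuous_comp (RInt g 0) exp 0 Hint).
  apply continuous_exp. }
assert (HXr : filterlim X (at_right 0) (at_right 0)).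
{ intros P HP; unfold filtermap, at_right, within in *.
  assert (HXc : continuous X 0)
    by (apply (ex_derive_continuous (K := R_AbsRing) (V := R_NormedModule));
        eexists; apply HX, H0).
  unfold continuous in HXc; rewrite HX0 in HXc.
  specialize (HXc _ HP); unfold filtermap in HXc.
  assert (Hloc : locally 0 (fun t => Rabs t < r))
    by (apply (locally_Rabs_lt _ r); [tauto|exact H0]).
  generalize (filter_and _ _ HXc Hloc); apply filter_imp.
  intros t [Ht1 Ht2] Ht; apply Ht1, Hpos.
  rewrite Rabs_pos_eq in Ht2; lra. }
assert (Hscal : filterlim (fun y => nu * y) (Rbar_locally m_infty)
                  (Rbar_locally m_infty)).
{ intros P [M HM]; exists (M / nu); intros y Hy; apply HM.
  apply (Rmult_lt_compat_l nu) in Hy; [|exact Hnu].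
  replace (nu * (M / nu)) with M in Hy by (field; lra); exact Hy. }
assert (Hpow : filterlim (fun t => Rpower (X t) nu) (at_right 0) (locally 0)).
{ unfold Rpower.
  apply filterlim_comp with (2 := is_lim_exp_m).
  apply filterlim_comp with (2 := Hscal).
  apply filterlim_comp with (1 := HXr).
  exact is_lim_ln_0. }
replace (locally 0) with (locally (mult (0 : R) (exp (RInt g 0 0))))
  by (f_equal; exact (Rmult_0_l _)).
apply (filterlim_comp_2 (H := locally (exp (RInt g 0 0)))
  (fun t => Rpower (X t) nu) (fun t => exp (RInt g 0 t)) Rmult Hpow Hexp).
apply (filterlim_mult (K := R_AbsRing)).
Qed.

(** * The generating function along a characteristic *)

(** Along [s |-> (T - s, X s)] the derivative of [X] produces [Q] times the
    [x]-derivative and that of [Phi] the zeroth-order terms, so together they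
    rebuild the transfer operator applied to [u], up to the term in [u 0]. *)
Lemma is_derive_characteristic_term A B C alpha0 beta0 gamma0
    (X Phi : R -> R) (u : nat -> R) M n T v :
  u M = 0 -> u (S M) = 0 -> X v <> 0 ->
  is_derive X v (Q A B C (X v)) ->
  is_derive Phi v (Phi v * (alpha0 * X v + gamma0 + (beta0 - C) / X v)) ->
  is_derive (fun s => (T - s) ^ n * (Phi s * height_poly u M (X s))) v
    ((T - v) ^ n *
       ((beta0 - C) * Phi v / X v * u O
        + Phi v * height_poly (last_step (affine A alpha0) (affine C beta0)
                         (affine B gamma0) u) M (X v))
     - INR n * (T - v) ^ pred n * (Phi v * height_poly u M (X v))).
Proof.
intros HuM HuSM HXv HX HPhi.
assert (Hrow : is_derive (fun s => height_poly u M (X s)) v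
                 (Q A B C (X v) * height_poly_derive u M (X v))).
{ apply (is_derive_comp (height_poly u M) X); [apply is_derive_height_poly|exact HX]. }
assert (Hlast := height_poly_last_step A B C alpha0 beta0 gamma0 u M (X v) HuM HuSM).
set (rl := height_poly (last_step _ _ _ _) M (X v)) in Hlast |- *.
assert (Hrl : rl = Q A B C (X v) * height_poly_derive u M (X v)
  + (alpha0 * X v + gamma0 + (beta0 - C) / X v) * height_poly u M (X v)
  - (beta0 - C) / X v * u O).
{ apply (Rmult_eq_reg_l (X v)); [|exact HXv].
  rewrite Hlast; field; exact HXv. }
rewrite Hrl; clear Hlast Hrl rl.
set (q := fun s => height_poly u M (X s)) in Hrow.
apply is_derive_ext with (fun s => (T - s) ^ n * (Phi s * q s)).
{ intros s; reflexivity. }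
change (height_poly u M (X v)) with (q v).
auto_derive.
{ repeat split; [eexists; exact HPhi|eexists; exact Hrow]. }
change (Derive (fun x => Phi x) v) with (Derive Phi v).
change (Derive (fun x => q x) v) with (Derive q v).
rewrite (is_derive_unique Phi v _ HPhi), (is_derive_unique q v _ Hrow).
replace (T + - v) with (T - v) by ring.
field; exact HXv.
Qed.

(** With [P_N t x] the generating function of the paths of length at most [N]
    that end at height at most [M], this is [Phi v * P_N (T - v) (X v)], the truncated
    generating function along a characteristic. The factor [Phi] is kept inside
    the sum so that each term is differentiated on its own. *)
Definition characteristic_sum (c : nat -> nat -> R) (X Phi : R -> R)
    (M N : nat) (T v : R) : R :=
  sum_n (fun n => (T - v) ^ n * (Phi v * height_poly (c n) M (X v))) N.

(** By the recurrence the transfer operator applied to [c n] is [n + 1] times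
    [c (n + 1)], so the term of index [n] contributes
    [(n + 1) (T - v)^n p_(n+1) - n (T - v)^(n-1) p_n] up to the factor [Phi]:
    the sum telescopes. Only the truncation error at order [N] and the terms in
    [c n 0], that is the kernel times the truncated return series, remain. *)
Lemma is_derive_characteristic_sum A B C alpha0 beta0 gamma0 (c : nat -> nat -> R)
    (X Phi : R -> R) M N T v :
  (N < M)%nat ->
  (forall n k, (n < k)%nat -> c n k = 0) ->
  (forall n k, INR (S n) * c (S n) k =
     last_step (affine A alpha0) (affine C beta0) (affine B gamma0) (c n) k) ->
  X v <> 0 ->
  is_derive X v (Q A B C (X v)) ->
  is_derive Phi v (Phi v * (alpha0 * X v + gamma0 + (beta0 - C) / X v)) ->
  is_derive (characteristic_sum c X Phi M N T) v
    ((beta0 - C) * Phi v / X v * height_poly (fun n => c n O) N (T - v)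
     + INR (S N) * (T - v) ^ N * (Phi v * height_poly (c (S N)) M (X v))).
Proof.
intros HNM Habove Hrec HXv HX HPhi.
assert (Hscale : forall n,
  height_poly (last_step (affine A alpha0) (affine C beta0) (affine B gamma0) (c n))
    M (X v) = INR (S n) * height_poly (c (S n)) M (X v)).
{ intros n; unfold height_poly.
  rewrite <- (sum_n_mult_l (K := R_AbsRing) (INR (S n))
                (fun k => c (S n) k * X v ^ k) M
              : _ = INR (S n) * sum_n (fun k => c (S n) k * X v ^ k) M).
  apply sum_n_ext; intros k; rewrite <- Hrec.
  exact (Rmult_assoc _ _ _). }
assert (Hterm : forall n, (n <= N)%nat ->
  is_derive (fun s => (T - s) ^ n * (Phi s * height_poly (c n) M (X s))) v
    ((T - v) ^ n * ((beta0 - C) * Phi v / X v * c n O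
       + Phi v * (INR (S n) * height_poly (c (S n)) M (X v)))
     - INR n * (T - v) ^ pred n * (Phi v * height_poly (c n) M (X v)))).
{ intros n Hn; rewrite <- Hscale.
  apply is_derive_characteristic_term; try assumption; apply Habove; lia. }
unfold characteristic_sum; clear HNM; induction N as [|N IH].
- apply is_derive_ext with (fun s => (T - s) ^ 0 * (Phi s * height_poly (c O) M (X s))).
  { intros s; rewrite sum_O; reflexivity. }
  rewrite height_poly_0.
  evar_last; [apply Hterm; lia|simpl; ring].
- apply is_derive_ext with (fun s => plus
    (sum_n (fun n => (T - s) ^ n * (Phi s * height_poly (c n) M (X s))) N)
    ((T - s) ^ S N * (Phi s * height_poly (c (S N)) M (X s)))).
  { intros s; rewrite sum_Sn; reflexivity. }
  evar_last.
  + apply (is_derive_plus (K := R_AbsRing) (V := R_NormedModule));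
    [apply IH; intros; apply Hterm; lia|apply Hterm; lia].
  + rewrite height_poly_succ; unfold plus; simpl; ring.
Qed.

Lemma height_poly_bound (u : nat -> R) (q x : R) M :
  (forall k, Rabs (u k) <= q) -> Rabs x <= 1 / 2 -> Rabs (height_poly u M x) <= 2 * q.
Proof.
intros Hu Hx.
assert (Hq : 0 <= q) by (eapply Rle_trans; [apply Rabs_pos|exact (Hu O)]).
assert (H : Rabs (height_poly u M x) <= q * (2 - (1 / 2) ^ M)).
{ induction M as [|M IH].
  - rewrite height_poly_0; simpl; specialize (Hu O); lra.
  - rewrite height_poly_succ; eapply Rle_trans; [apply Rabs_triang|].
    rewrite Rabs_mult, <- RPow_abs.
    assert (Hp : Rabs x ^ S M <= (1 / 2) ^ S M)
      by (apply pow_incr; split; [apply Rabs_pos|exact Hx]).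
    assert (Hm : Rabs (u (S M)) * Rabs x ^ S M <= q * (1 / 2) ^ S M).
    { apply Rmult_le_compat; [apply Rabs_pos|apply pow_le, Rabs_pos|apply Hu|exact Hp]. }
    simpl pow in Hm |- *; lra. }
assert (Hp : 0 <= (1 / 2) ^ M) by (apply pow_le; lra).
nra.
Qed.

Lemma characteristic_sum_bound (c : nat -> nat -> R) (X Phi : R -> R) rho M N T v :
  0 < rho -> (forall n k, Rabs (c n k) <= rho ^ n) ->
  Rabs (X v) <= 1 / 2 -> 0 <= T - v -> rho * (T - v) <= 1 / 2 ->
  Rabs (characteristic_sum c X Phi M N T v) <= 4 * Rabs (Phi v).
Proof.
intros Hrho Hc HX HT Hsmall.
assert (HP := Rabs_pos (Phi v)).
assert (H : Rabs (characteristic_sum c X Phi M N T v)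
            <= 2 * Rabs (Phi v) * (2 - (1 / 2) ^ N)).
{ assert (Hterm : forall n, Rabs ((T - v) ^ n * (Phi v * height_poly (c n) M (X v)))
            <= 2 * Rabs (Phi v) * (1 / 2) ^ n).
  { intros n; rewrite !Rabs_mult, <- RPow_abs, (Rabs_pos_eq (T - v)) by exact HT.
    assert (Hr := height_poly_bound (c n) (rho ^ n) (X v) M (Hc n) HX).
    assert (Hp : (rho * (T - v)) ^ n <= (1 / 2) ^ n).
    { apply pow_incr; split; [apply Rmult_le_pos; lra|exact Hsmall]. }
    rewrite Rpow_mult_distr in Hp.
    assert (HTn : 0 <= (T - v) ^ n) by (apply pow_le, HT).
    apply Rle_trans with ((T - v) ^ n * (Rabs (Phi v) * (2 * rho ^ n))).
    - apply Rmult_le_compat_l; [exact HTn|].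
      apply Rmult_le_compat_l; assumption.
    - replace ((T - v) ^ n * (Rabs (Phi v) * (2 * rho ^ n)))
        with (2 * Rabs (Phi v) * (rho ^ n * (T - v) ^ n)) by ring.
      apply Rmult_le_compat_l; lra. }
  unfold characteristic_sum; induction N as [|N IH].
  - rewrite sum_O; eapply Rle_trans; [apply Hterm|simpl; lra].
  - rewrite sum_n_succ; eapply Rle_trans; [apply Rabs_triang|].
    specialize (Hterm (S N)); simpl pow in Hterm |- *; lra. }
assert (Hp : 0 <= (1 / 2) ^ N) by (apply pow_le; lra).
nra.
Qed.

(** * The convolution equation up to a small error *)

Lemma characteristic_sum_end (c : nat -> nat -> R) (X Phi : R -> R) M N T :
  (forall k, c O k = if Nat.eqb 0 k then 1 else 0) ->
  characteristic_sum c X Phi M N T T = Phi T.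
Proof.
intros Hc0.
assert (Hrow : height_poly (c O) M (X T) = 1).
{ induction M as [|M IH].
  - rewrite height_poly_0, Hc0; reflexivity.
  - rewrite height_poly_succ, IH, Hc0; simpl; ring. }
unfold characteristic_sum; induction N as [|N IH].
- rewrite sum_O, Hrow; simpl; ring.
- rewrite sum_n_succ, IH, Rminus_diag, pow_i by lia; ring.
Qed.

(** Bernoulli's inequality [1 + N / 2 <= (3 / 2) ^ N] absorbs the linear factor
    of the truncation error into a slower geometric decay. *)
Lemma linear_geom N : INR (S N) * (1 / 2) ^ N <= 2 * (3 / 4) ^ N.
Proof.
assert (H : 1 + INR N * (1 / 2) <= (1 + 1 / 2) ^ N) by (apply poly; lra).
replace ((3 / 4) ^ N) with ((1 + 1 / 2) ^ N * (1 / 2) ^ N)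
  by (rewrite <- Rpow_mult_distr; f_equal; lra).
assert (Hp : 0 <= (1 / 2) ^ N) by (apply pow_le; lra).
rewrite S_INR; nra.
Qed.

Lemma geom_vanish K x :
  (forall N, x <= K * (3 / 4) ^ N) -> x <= 0.
Proof.
intros H.
assert (Hlim : is_lim_seq (fun N => K * (3 / 4) ^ N) 0).
{ replace (Finite 0) with (Rbar_mult K 0) by (simpl; f_equal; ring).
  apply is_lim_seq_scal_l, is_lim_seq_geom.
  rewrite Rabs_pos_eq; lra. }
exact (is_lim_seq_le (fun _ => x) _ x 0 H (is_lim_seq_const x) Hlim).
Qed.

Lemma bounded_on_segment (f : R -> R) a b :
  (forall x, a <= x <= b -> continuous f x) ->
  exists K, 0 <= K /\ forall x, a <= x <= b -> Rabs (f x) <= K.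
Proof.
intros Hf.
destruct (bounded_continuity (K := R_AbsRing) (V := R_NormedModule) f a b Hf)
  as [K HK].
exists (Rmax 0 K); split; [apply Rmax_l|].
intros x Hx; apply Rle_trans with K; [|apply Rmax_r].
apply Rlt_le; exact (HK x Hx).
Qed.

(** Integrate the derivative of [characteristic_sum] from [eps] to [T]. At
    [v = T] the sum equals [Phi T], because the empty path is the only path of
    length 0; at [v = eps] it is at most [4 * Phi eps]. On the segment the
    derivative converges uniformly to the kernel times [w (T - v)] as the
    truncation order grows. Staying away from 0 keeps the kernel bounded. *)
Lemma truncated_convolution A B C alpha0 beta0 gamma0 (c : nat -> nat -> R)
    (X Phi w : R -> R) rho eps T :
  (forall n k, (n < k)%nat -> c n k = 0) ->
  (forall n k, INR (S n) * c (S n) k =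
     last_step (affine A alpha0) (affine C beta0) (affine B gamma0) (c n) k) ->
  (forall k, c O k = if Nat.eqb 0 k then 1 else 0) ->
  0 < rho -> (forall n k, Rabs (c n k) <= rho ^ n) ->
  0 < eps < T -> rho * T <= 1 / 2 ->
  (forall v, eps <= v <= T -> 0 < X v <= 1 / 2) ->
  (forall v, eps <= v <= T -> is_derive X v (Q A B C (X v))) ->
  (forall v, eps <= v <= T ->
     is_derive Phi v (Phi v * (alpha0 * X v + gamma0 + (beta0 - C) / X v))) ->
  (forall t, 0 <= t <= T -> continuous w t) ->
  (forall t, 0 <= t <= T -> is_pseries (fun n => c n O) t (w t)) ->
  exists y, is_RInt (fun v => (beta0 - C) * Phi v / X v * w (T - v)) eps T y /\
    Rabs (Phi T - y) <= 4 * Rabs (Phi eps).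
Proof.
intros Habove Hrec Hc0 Hrho Hc Heps HT HX HdX HdPhi Hwc Hw.
set (l := fun v => (beta0 - C) * Phi v / X v).
assert (Hseg : forall v, Rmin eps T <= v <= Rmax eps T -> eps <= v <= T).
{ intros v; rewrite Rmin_left, Rmax_right by lra; tauto. }
assert (HPhic : forall v, eps <= v <= T -> continuous Phi v).
{ intros v Hv; apply (ex_derive_continuous (K := R_AbsRing) (V := R_NormedModule)).
  eexists; apply (HdPhi v), Hv. }
assert (Hlc : forall v, eps <= v <= T -> continuous l v).
{ intros v Hv; apply (ex_derive_continuous (K := R_AbsRing) (V := R_NormedModule)).
  unfold l; auto_derive.
  repeat split; [eexists; apply (HdPhi v), Hv|eexists; apply (HdX v), Hv|].
  apply Rgt_not_eq, (HX v), Hv. }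
assert (Hlwc : forall v, eps <= v <= T -> continuous (fun v => l v * w (T - v)) v).
{ intros v Hv.
  apply (continuous_mult (K := R_AbsRing) l (fun v => w (T - v))); [apply Hlc, Hv|].
  apply (continuous_comp (fun v => T - v) w); [|apply Hwc; lra].
  apply (ex_derive_continuous (K := R_AbsRing) (V := R_NormedModule)).
  auto_derive; exact I. }
assert (Hex : ex_RInt (fun v => l v * w (T - v)) eps T).
{ apply (ex_RInt_continuous (V := R_CompleteNormedModule)).
  intros v Hv; apply Hlwc, Hseg, Hv. }
destruct Hex as [y Hy].
exists y; split; [exact Hy|].
destruct (bounded_on_segment l eps T Hlc) as [Kl [HKl0 HKl]].
destruct (bounded_on_segment Phi eps T HPhic) as [KP [HKP0 HKP]].
enough (Hgeom : Rabs (Phi T - y) - 4 * Rabs (Phi eps) <= 0) by lra.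
apply geom_vanish with ((T - eps) * (Kl + 4 * rho * KP)); intros N.
set (D := fun v => l v * height_poly (fun n => c n O) N (T - v)
  + INR (S N) * (T - v) ^ N * (Phi v * height_poly (c (S N)) (S N) (X v))).
assert (HD : is_RInt D eps T
   (minus (characteristic_sum c X Phi (S N) N T T)
          (characteristic_sum c X Phi (S N) N T eps))).
{ apply (is_RInt_derive (V := R_CompleteNormedModule)
           (characteristic_sum c X Phi (S N) N T)).
  - intros v Hv; apply Hseg in Hv.
    apply (is_derive_characteristic_sum A B C alpha0 beta0 gamma0); auto.
    apply Rgt_not_eq, (HX v), Hv.
  - intros v Hv; apply Hseg in Hv.
    set (p := height_poly (fun n => c n O) N) in D.
    set (q := height_poly (c (S N)) (S N)) in D.
    apply (continuous_plus (K := R_AbsRing) (V := R_NormedModule)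
             (fun v => l v * p (T - v))
             (fun v => INR (S N) * (T - v) ^ N * (Phi v * q (X v)))).
    + apply (continuous_mult (K := R_AbsRing) l (fun v => p (T - v)));
      [apply Hlc, Hv|].
      apply (ex_derive_continuous (K := R_AbsRing) (V := R_NormedModule)).
      auto_derive.
      eexists; apply is_derive_height_poly.
    + apply (ex_derive_continuous (K := R_AbsRing) (V := R_NormedModule)).
      auto_derive; repeat split.
      * eexists; apply (HdPhi v), Hv.
      * eexists; apply is_derive_height_poly.
      * eexists; apply (HdX v), Hv. }
assert (Hdiff := is_RInt_minus (V := R_NormedModule) _ _ _ _ _ _ HD Hy).
rewrite characteristic_sum_end in Hdiff by exact Hc0.
assert (Hnorm : Rabs (Phi T - characteristic_sum c X Phi (S N) N T eps - y)
  <= (T - eps) * ((Kl + 4 * rho * KP) * (3 / 4) ^ N)).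
{ apply (norm_RInt_le_const (V := R_NormedModule) (fun v => D v - l v * w (T - v))
           eps T); [lra| |exact Hdiff].
  intros v Hv.
  change (Rabs (D v - l v * w (T - v)) <= (Kl + 4 * rho * KP) * (3 / 4) ^ N).
  assert (Hsmall : 0 <= rho * (T - v) <= 1 / 2) by (split; nra).
  assert (Hpow : forall n, (rho * (T - v)) ^ n <= (1 / 2) ^ n)
    by (intros n; apply pow_incr, Hsmall).
  assert (Htail :
    Rabs (w (T - v) - height_poly (fun n => c n O) N (T - v)) <= (1 / 2) ^ N).
  { apply geom_tail.
    - apply is_pseries_R, Hw; lra.
    - intros n; rewrite Rabs_mult, <- RPow_abs, (Rabs_pos_eq (T - v)) by lra.
      apply Rle_trans with (2 := Hpow n).
      rewrite Rpow_mult_distr.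
      apply Rmult_le_compat_r; [apply pow_le; lra|apply Hc]. }
  assert (Hrow : Rabs (height_poly (c (S N)) (S N) (X v)) <= 2 * rho ^ S N).
  { apply height_poly_bound; [apply Hc|].
    specialize (HX v Hv); rewrite Rabs_pos_eq; lra. }
  (* Compare with the limit: the tail of the return series, plus the truncation
   error of the telescoping sum. *)
replace (D v - l v * w (T - v)) with
    (- (l v * (w (T - v) - height_poly (fun n => c n O) N (T - v)))
     + INR (S N) * (Phi v * ((T - v) ^ N * height_poly (c (S N)) (S N) (X v))))
    by (unfold D; ring).
  assert (Hlin := linear_geom N).
  assert (Hhalf : (1 / 2) ^ N <= (3 / 4) ^ N) by (apply pow_incr; lra).
  assert (Hhalf0 : 0 <= (1 / 2) ^ N) by (apply pow_le; lra).
  eapply Rle_trans; [apply Rabs_triang|].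
  rewrite Rabs_Ropp, !Rabs_mult, (Rabs_pos_eq (INR (S N))) by apply pos_INR.
  rewrite <- RPow_abs, (Rabs_pos_eq (T - v)) by lra.
  assert (H1 : Rabs (l v) * Rabs (w (T - v) - height_poly (fun n => c n O) N (T - v))
               <= Kl * (3 / 4) ^ N).
  { apply Rmult_le_compat; try apply Rabs_pos; [apply HKl, Hv|lra]. }
  assert (H2 : (T - v) ^ N * Rabs (height_poly (c (S N)) (S N) (X v))
               <= 2 * rho * (1 / 2) ^ N).
  { apply Rle_trans with ((T - v) ^ N * (2 * rho ^ S N)).
    - apply Rmult_le_compat_l; [apply pow_le; lra|exact Hrow].
    - specialize (Hpow N); rewrite Rpow_mult_distr in Hpow.
      replace ((T - v) ^ N * (2 * rho ^ S N))
        with (2 * rho * (rho ^ N * (T - v) ^ N)) by (simpl pow; ring).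
      apply Rmult_le_compat_l; lra. }
  assert (H3 : Rabs (Phi v) * ((T - v) ^ N * Rabs (height_poly (c (S N)) (S N) (X v)))
               <= KP * (2 * rho * (1 / 2) ^ N)).
  { apply Rmult_le_compat; [apply Rabs_pos| |apply HKP, Hv|exact H2].
    apply Rmult_le_pos; [apply pow_le; lra|apply Rabs_pos]. }
  apply (Rmult_le_compat_l (INR (S N))) in H3; [|apply pos_INR].
  apply (Rmult_le_compat_l (2 * rho * KP)) in Hlin; [|nra].
  nra. }
(* The value at the lower end of the segment is the only error left in the
   limit of large [N]. *)
assert (Hcorner : Rabs (characteristic_sum c X Phi (S N) N T eps) <= 4 * Rabs (Phi eps)).
{ apply (characteristic_sum_bound c X Phi rho); [exact Hrho|exact Hc| |lra|nra].
  assert (HXe := HX eps ltac:(lra)); rewrite Rabs_pos_eq; lra. }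
assert (Htri := Rabs_triang (Phi T - characteristic_sum c X Phi (S N) N T eps - y)
                  (characteristic_sum c X Phi (S N) N T eps)).
replace (Phi T - characteristic_sum c X Phi (S N) N T eps - y
         + characteristic_sum c X Phi (S N) N T eps)
  with (Phi T - y) in Htri by ring.
lra.
Qed.

(** * Uniqueness and the main result *)

(** For a positive integrand the truncated integrals over [[e, T]] with
    [e < T / 2] stay above the fixed positive integral over [[T / 2, T]]. *)
Lemma RInt_gen_pos_neq_0 (g : R -> R) T :
  0 < T -> (forall v, 0 < v < T -> 0 < g v) ->
  (forall v, 0 < v <= T -> continuous g v) ->
  ~ is_RInt_gen g (at_right 0) (at_point T) 0.
Proof.
intros HT Hpos Hcont Hg.
assert (Hm : 0 < RInt g (T / 2) T).
{ apply RInt_gt_0; [lra|intros; apply Hpos; lra|intros; apply Hcont; lra]. }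
assert (Hball : locally (0 : R) (fun y => Rabs y < RInt g (T / 2) T)).
{ apply (locally_Rabs_lt _ (RInt g (T / 2) T)); [tauto|].
  rewrite Rabs_R0; exact Hm. }
destruct (Hg _ Hball) as [P P' HP HP' HPP].
assert (Hlt : at_right 0 (fun e => 0 < e < T / 2)).
{ assert (HT2 : 0 < T / 2) by lra.
  exists (mkposreal _ HT2); intros e He He0; split; [exact He0|].
  change (Rabs (e - 0) < T / 2) in He; apply Rabs_def2 in He; lra. }
destruct (filter_ex _ (filter_and _ _ HP Hlt)) as [e [He1 He2]].
destruct (HPP e T He1 HP') as [y [Hy1 Hy2]]; simpl in Hy1.
assert (Hint : forall a b, 0 < a <= b -> b <= T -> ex_RInt g a b).
{ intros a b Ha Hb; apply (ex_RInt_continuous (V := R_CompleteNormedModule)).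
  intros z; rewrite Rmin_left, Rmax_right by lra; intros Hz; apply Hcont; lra. }
assert (Hsplit := RInt_Chasles (V := R_CompleteNormedModule) g e (T / 2) T
  (Hint e (T / 2) ltac:(lra) ltac:(lra)) (Hint (T / 2) T ltac:(lra) ltac:(lra))).
rewrite (is_RInt_unique (V := R_CompleteNormedModule) _ _ _ _ Hy1) in Hsplit.
assert (Hle : 0 < RInt g e (T / 2)).
{ apply RInt_gt_0; [lra|intros; apply Hpos; lra|intros; apply Hcont; lra]. }
unfold plus in Hsplit; simpl in Hsplit.
apply Rabs_def2 in Hy2; lra.
Qed.

Lemma expansion_of_bound (a : nat -> R) rho :
  0 < rho -> (forall n, Rabs (a n) <= rho ^ n) ->
  forall x, rho * Rabs x <= 1 / 2 -> is_pseries a x (PSeries a x).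
Proof.
intros Hrho Ha x Hx.
apply PSeries_correct, ex_pseries_R.
apply (ex_series_le (K := R_AbsRing) (V := R_CompleteNormedModule))
  with (fun n => (1 / 2) ^ n).
- intros n; change (Rabs (a n * x ^ n) <= (1 / 2) ^ n).
  rewrite Rabs_mult, <- RPow_abs.
  apply Rle_trans with (rho ^ n * Rabs x ^ n).
  + apply Rmult_le_compat_r; [apply pow_le, Rabs_pos|apply Ha].
  + rewrite <- Rpow_mult_distr; apply pow_incr; split; [|exact Hx].
    apply Rmult_le_pos; [lra|apply Rabs_pos].
- exists (/ (1 - 1 / 2)); apply is_series_geom; rewrite Rabs_pos_eq; lra.
Qed.

Lemma at_right_0_lt r : 0 < r -> at_right 0 (fun t => 0 < t < r).
Proof.
intros Hr; exists (mkposreal r Hr); intros t Ht Ht0; split; [exact Ht0|].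
change (Rabs (t - 0) < r) in Ht; apply Rabs_def2 in Ht; lra.
Qed.

(** The difference [U] of two solutions has zero convolution with [l]. If its
    first non-zero coefficient is [dn] then [dn * U] is positive just to the
    right of 0, as is [l], so the convolution would be positive. *)
Lemma convolution_equation_unique (f l V V' : R -> R) (b a : nat -> R) :
  has_expansion_at_0 V b -> has_expansion_at_0 V' a ->
  at_right 0 (fun v => 0 < l v) -> at_right 0 (fun v => continuous l v) ->
  convolution_equation f l V -> convolution_equation f l V' ->
  forall n, b n = a n.
Proof.
intros HV HW Hl Hlc HcV HcW.
enough (Hd : forall n, PS_minus b a n = 0).
{ intros n; apply Rminus_diag_uniq; exact (Hd n). }
set (U := fun t => V t - V' t).
assert (HU : has_expansion_at_0 U (PS_minus b a)).
{ unfold has_expansion_at_0 in *.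
  generalize (filter_and _ _ HV HW); apply filter_imp.
  intros x [H1 H2]; exact (is_pseries_minus _ _ _ _ _ H1 H2). }
destruct (expansion_continuous _ _ HU) as [rc [Hrc HUc]].
intros n; induction n as [n IH] using (well_founded_induction lt_wf).
destruct (Req_dec (PS_minus b a n) 0) as [H0|Hne]; [exact H0|exfalso].
set (dn := PS_minus b a n : R) in Hne.
assert (HdU : has_expansion_at_0 (fun t => dn * U t) (PS_scal dn (PS_minus b a))).
{ unfold has_expansion_at_0 in *; revert HU; apply filter_imp; intros x Hx.
  apply (is_pseries_scal (K := R_AbsRing) (V := R_NormedModule) dn);
  [apply Rmult_comm|exact Hx]. }
destruct (expansion_pos _ _ n HdU) as [rp [Hrp HUp]].
{ intros k Hk; unfold PS_scal; rewrite IH by exact Hk; exact (Rmult_0_r dn). }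
{ change (0 < dn * dn); nra. }
destruct Hl as [rl Hl]; destruct Hlc as [rlc Hlc].
assert (Hmin : 0 < Rmin (Rmin rc rp) (Rmin rl rlc)).
{ repeat apply Rmin_pos; try assumption; apply cond_pos. }
destruct (filter_ex _ (filter_and _ _ (at_right_0_lt _ Hmin)
                         (filter_and _ _ HcV HcW))) as [T [HT [HTV HTW]]].
assert (H1 := Rmin_l (Rmin rc rp) (Rmin rl rlc)).
assert (H2 := Rmin_r (Rmin rc rp) (Rmin rl rlc)).
assert (H3 := Rmin_l rc rp); assert (H4 := Rmin_r rc rp).
assert (H5 := Rmin_l rl rlc); assert (H6 := Rmin_r rl rlc).
apply (RInt_gen_pos_neq_0 (fun v => l v * (dn * U (T - v))) T); [lra| | |].
- intros v Hv; apply Rmult_lt_0_compat; [|apply HUp; lra].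
  apply Hl; [|lra]; change (Rabs (v - 0) < rl); rewrite Rabs_pos_eq; lra.
- intros v Hv.
  apply (continuous_mult (K := R_AbsRing) l (fun v => dn * U (T - v))).
  + apply Hlc; [|lra]; change (Rabs (v - 0) < rlc); rewrite Rabs_pos_eq; lra.
  + apply (continuous_scal_r (K := R_AbsRing) (V := R_NormedModule) dn
             (fun v => U (T - v))).
    apply (continuous_comp (fun v => T - v) U);
    [|apply HUc; rewrite Rabs_pos_eq; lra].
    apply (ex_derive_continuous (K := R_AbsRing) (V := R_NormedModule)).
    auto_derive; exact I.
- assert (Hdiff : is_RInt_gen (V := R_NormedModule)
    (fun v => dn * (l v * V (T - v) - l v * V' (T - v)))
    (at_right 0) (at_point T) (dn * (f T - f T))).
  { apply (is_RInt_gen_scal (V := R_NormedModule)).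
    exact (is_RInt_gen_minus (V := R_NormedModule) _ _ _ _ HTV HTW). }
  rewrite Rminus_diag, Rmult_0_r in Hdiff.
  apply (is_RInt_gen_ext (V := R_NormedModule)) with (2 := Hdiff).
  exists (fun _ => True) (fun _ => True); [apply filter_true|apply filter_true|].
  intros x y _ _ v _; simpl.
  change (dn * (l v * V (T - v) - l v * V' (T - v))
          = l v * (dn * (V (T - v) - V' (T - v)))).
  ring.
Qed.

Theorem theorem2p1 (A B C alpha0 beta0 gamma0 : R)
    (HC : 0 < C) (Hbeta0 : C < beta0)
    (X : R -> R) (HX : riccati_solution A B C X) :
  let delta := beta0 - C in
  let nu := (beta0 - C) / C in
  let Fnu := F A B alpha0 gamma0 nu X in
  let Lnu := L A B alpha0 gamma0 nu delta X in
  let W0 := W A B C alpha0 beta0 gamma0 in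
  (has_expansion_at_0 W0 (return_coeff A B C alpha0 beta0 gamma0) /\
   analytic_at_0 W0 /\
   W0 0 = 1 /\
   convolution_equation Fnu Lnu W0) /\
  (forall V : R -> R,
     analytic_at_0 V -> V 0 = 1 -> convolution_equation Fnu Lnu V ->
     locally 0 (fun t => V t = W0 t)).
Proof.
intros delta nu Fnu Lnu W0.
set (a := return_coeff A B C alpha0 beta0 gamma0).
assert (Hnu : 0 < nu) by (apply Rdiv_lt_0_compat; lra).
assert (HnuC : nu * C = beta0 - C) by (unfold nu; field; lra).
destruct (riccati_near_0 A B C X HC HX) as [r [Hr [HdX HXpos]]].
destruct HX as [HX0 _].
assert (HdF : forall t, 0 < t < r ->
  is_derive Fnu t (Fnu t * (alpha0 * X t + gamma0 + (beta0 - C) / X t))).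
{ intros t Ht; rewrite <- HnuC; apply (is_derive_F A B C) with r;
  [exact HdX|intros s Hs; apply HXpos, Hs|exact Ht]. }
assert (HF0 : filterlim Fnu (at_right 0) (locally 0)).
{ apply (F_lim_0 A B C) with r; try assumption.
  intros s Hs; apply HXpos, Hs. }
destruct (path_coeff_bound A B C alpha0 beta0 gamma0) as [rho [Hrho Hbound]].
assert (Hconv : forall x, rho * Rabs x <= 1 / 2 -> is_pseries a x (W0 x)).
{ apply expansion_of_bound; [exact Hrho|intros n; apply (Hbound n O)]. }
assert (Hrho2 : 0 < / (2 * rho)) by (apply Rinv_0_lt_compat; lra).
assert (Hsmall : forall x, x <= / (2 * rho) -> rho * x <= 1 / 2).
{ intros x Hx; apply Rle_trans with (rho * / (2 * rho)).
  - apply Rmult_le_compat_l; lra.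
  - right; field; lra. }
assert (HW : has_expansion_at_0 W0 a).
{ apply locally_0_Rabs; exists (/ (2 * rho)); split; [exact Hrho2|].
  intros x Hx; apply Hconv, Hsmall; lra. }
assert (Hequation : convolution_equation Fnu Lnu W0).
{ destruct (expansion_continuous _ _ HW) as [rc [Hrc HWc]].
  assert (Hmin : 0 < Rmin r (Rmin rc (/ (2 * rho))))
    by (repeat apply Rmin_pos; assumption).
  unfold convolution_equation.
  generalize (at_right_0_lt _ Hmin); apply filter_imp; intros T [HT0 HT].
  assert (H1 := Rmin_l r (Rmin rc (/ (2 * rho)))).
  assert (H2 := Rmin_r r (Rmin rc (/ (2 * rho)))).
  assert (H3 := Rmin_l rc (/ (2 * rho))).
  assert (H4 := Rmin_r rc (/ (2 * rho))).
  intros P [e He].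
  assert (He4 : 0 < e / 4) by (assert (H := cond_pos e); lra).
  assert (HFe := HF0 _ (locally_ball (0 : R_UniformSpace) (mkposreal _ He4))).
  unfold filtermap in HFe.
  (* Any [eps] with [4 * Fnu eps] below the tolerance will do. *)
exists (fun eps => (0 < eps < T) /\ Rabs (Fnu eps) < e / 4) (fun y => y = T).
  - generalize (filter_and _ _ (at_right_0_lt _ HT0) HFe); apply filter_imp.
    intros eps [Heps1 Heps2]; split; [exact Heps1|].
    change (Rabs (Fnu eps - 0) < e / 4) in Heps2.
    rewrite Rminus_0_r in Heps2; exact Heps2.
  - reflexivity.
  - intros eps T' [Heps HFeps] ->.
    destruct (truncated_convolution A B C alpha0 beta0 gamma0
      (path_coeff A B C alpha0 beta0 gamma0) X Fnu W0 rho eps T)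
      as [y [Hy1 Hy2]]; try assumption.
    + apply path_coeff_above.
    + apply path_coeff_last_step.
    + apply path_coeff_0.
    + apply Hsmall; lra.
    + intros v Hv; apply HXpos; lra.
    + intros v Hv; apply HdX; rewrite Rabs_pos_eq; lra.
    + intros v Hv; apply HdF; lra.
    + intros t Ht; apply HWc; rewrite Rabs_pos_eq; lra.
    + intros t Ht; apply Hconv, Hsmall; rewrite Rabs_pos_eq; lra.
    + exists y; split; [exact Hy1|].
      apply He; change (Rabs (y - Fnu T) < e).
      rewrite Rabs_minus_sym; lra. }
split; [split; [exact HW|split; [exists a; exact HW|split; [|exact Hequation]]]|].
- unfold W0, W; rewrite PSeries_0.
  exact (path_coeff_0 A B C alpha0 beta0 gamma0 O).
- intros V [b HV] _ HcV.
  assert (Hba : forall n, b n = a n).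
  { apply (convolution_equation_unique Fnu Lnu V W0); try assumption.
    - generalize (at_right_0_lt _ Hr); apply filter_imp; intros v Hv.
      unfold Lnu, L; apply Rdiv_lt_0_compat; [|apply HXpos, Hv].
      apply Rmult_lt_0_compat; [unfold delta; lra|apply F_pos].
    - generalize (at_right_0_lt _ Hr); apply filter_imp; intros v Hv.
      apply (ex_derive_continuous (K := R_AbsRing) (V := R_NormedModule)).
      change (ex_derive (fun v => delta * Fnu v / X v) v).
      auto_derive; repeat split.
      + eexists; apply (HdF v Hv).
      + eexists; apply HdX; rewrite Rabs_pos_eq; lra.
      + apply Rgt_not_eq, (HXpos v Hv). }
  unfold has_expansion_at_0 in *.
  generalize (filter_and _ _ HV HW); apply filter_imp; intros t [Ht1 Ht2].
  rewrite <- (is_pseries_unique _ _ _ Ht1), <- (is_pseries_unique _ _ _ Ht2).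
  apply PSeries_ext, Hba.
Qed.
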